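(* For every formula $\varphi\in\mathcal{ONL}_n$: if $\varphi$ is provable in $\mathrm{AX}'$ then so is $\mathit{Val}(\varphi)$, while if $\varphi$ is not provable in $\mathrm{AX}'$, then $\neg\mathit{Val}(\varphi)$ is provable in $\mathrm{AX}'$.
   Context: Fix a nonempty set $\Phi$ of primitive propositions and a number $n$ of agents $1,\dots,n$. The language $\mathcal{ONL}_n$ is formed from $\Phi$ by closing off under $\neg,\lor$ and unary modalities $L_i,N_i$ ($1\le i\le n$). $\mathcal{ONL}_n^+$ is the extension of $\mathcal{ONL}_n$ by a further unary modal operator $\mathit{Val}$; $\mathit{Sat}(\varphi)$ abbreviates $\neg\mathit{Val}(\neg\varphi)$. A formula is $i$-objective if it is a Boolean combination of primitive propositions and formulas of the form $L_j\varphi$ and $N_j\varphi$ with $j\ne i$ ($\varphi$ arbitrary); it is $i$-subjective if it is a Boolean combination of formulas of the form $L_i\varphi$ and $N_i\varphi$. Axiom system $\mathrm{AX}'$ (formulas range over $\mathcal{ONL}_n^+$, $i$ over agents): A1$_n$: axioms of propositional logic. A2$_n$: $L_i(\alpha\Rightarrow\beta)\Rightarrow(L_i\alpha\Rightarrow L_i\beta)$. A3$_n$: $N_i(\alpha\Rightarrow\beta)\Rightarrow(N_i\alpha\Rightarrow N_i\beta)$. A4$_n$: $\sigma\Rightarrow L_i\sigma\land N_i\sigma$ if $\sigma$ is $i$-subjective. A5$'_n$: $\mathit{Sat}(\neg\alpha)\Rightarrow(N_i\alpha\Rightarrow\neg L_i\alpha)$ if $\alpha$ is $i$-objective. V1: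 $(\mathit{Val}(\varphi)\land\mathit{Val}(\varphi\Rightarrow\psi))\Rightarrow\mathit{Val}(\psi)$. V2: $\mathit{Sat}(\varphi)$ if $\varphi$ is a satisfiable propositional formula. V3: $(\mathit{Sat}(\alpha\land\beta_1)\land\dots\land\mathit{Sat}(\alpha\land\beta_k)\land\mathit{Sat}(\gamma\land\delta_1)\land\dots\land\mathit{Sat}(\gamma\land\delta_m)\land\mathit{Val}(\alpha\lor\gamma))\Rightarrow\mathit{Sat}(L_i\alpha\land\neg L_i\neg\beta_1\land\dots\land\neg L_i\neg\beta_k\land N_i\gamma\land\neg N_i\neg\delta_1\land\dots\land\neg N_i\neg\delta_m)$ if $\alpha,\beta_1,\dots,\beta_k,\gamma,\delta_1,\dots,\delta_m$ are $i$-objective ($k,m\ge 0$). V4: $(\mathit{Sat}(\alpha)\land\mathit{Sat}(\beta))\Rightarrow\mathit{Sat}(\alpha\land\beta)$ if $\alpha$ is $i$-objective and $\beta$ is $i$-subjective. Rules: modus ponens; from $\alpha$ infer $L_i\alpha$ and $N_i\alpha$; from $\varphi$ infer $\mathit{Val}(\varphi)$. *)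

(* Defs.v *)
From mathcomp Require Import all_boot.

Set Implicit Arguments.
Unset Strict Implicit.
Unset Printing Implicit Defensive.

(* The language ONL_n^+ over the primitive propositions [Phi] and the agents
   ['I_n]; only negation and disjunction are primitive connectives. *)
Inductive form (Phi : Type) (n : nat) : Type :=
| Atom of Phi
| Not of form Phi n
| Or of form Phi n & form Phi n
| L of 'I_n & form Phi n
| N of 'I_n & form Phi n
| Val of form Phi n.

Arguments Atom {Phi n}.

Section Syntax.
Variables (Phi : Type) (n : nat).
Implicit Types (phi psi : form Phi n) (i : 'I_n).

Definition Imp phi psi := Or (Not phi) psi.
Definition And phi psi := Not (Or (Not phi) (Not psi)).
Definition Sat phi := Not (Val (Not phi)).

(* [phi] belongs to the sublanguage ONL_n, i.e. [Val] does not occur in it. *)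
Fixpoint in_ONL phi : bool :=
  match phi with
  | Atom _ => true
  | Not a => in_ONL a
  | Or a b => in_ONL a && in_ONL b
  | L _ a => in_ONL a
  | N _ a => in_ONL a
  | Val _ => false
  end.

Fixpoint propositional phi : bool :=
  match phi with
  | Atom _ => true
  | Not a => propositional a
  | Or a b => propositional a && propositional b
  | _ => false
  end.

(* A formula [Val phi] is neither i-objective nor i-subjective, but [Val] may
   occur below [L j] and [N j]. *)
Fixpoint objective i phi : bool :=
  match phi with
  | Atom _ => true
  | Not a => objective i a
  | Or a b => objective i a && objective i b
  | L j _ => j != i
  | N j _ => j != i
  | Val _ => false
  end.

Fixpoint subjective i phi : bool :=
  match phi with
  | Atom _ => false
  | Not a => subjective i a
  | Or a b => subjective i a && subjective i b
  | L j _ => j == i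
  | N j _ => j == i
  | Val _ => false
  end.

(* Propositional evaluation: every formula that is not a negation or a
   disjunction is treated as a propositional letter, valued by [v]. *)
Fixpoint beval (v : form Phi n -> bool) phi : bool :=
  match phi with
  | Not a => ~~ beval v a
  | Or a b => beval v a || beval v b
  | _ => v phi
  end.

(* Substitution instances of propositional tautologies. *)
Definition tautology phi : Prop := forall v, beval v phi.

Definition satisfiable phi : Prop := exists v, beval v phi.

(* The conjunction of the nonempty list [phi :: s]; the language has no truth
   constant for the empty conjunction. *)
Fixpoint bigAnd phi (s : seq (form Phi n)) : form Phi n :=
  if s is psi :: s' then And phi (bigAnd psi s') else phi.

(* In V3 the lists [bs] and [ds] hold beta_1, ..., beta_k and
   delta_1, ..., delta_m.  Its premise is the conjunction of the
   Sat(alpha /\ beta_j), the Sat(gamma /\ delta_j) and Val(alpha \/ gamma),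
   written with [foldr] because the first two families may be empty. *)
Inductive AX' : form Phi n -> Prop :=
| A1 phi : tautology phi -> AX' phi
| A2 i a b : AX' (Imp (L i (Imp a b)) (Imp (L i a) (L i b)))
| A3 i a b : AX' (Imp (N i (Imp a b)) (Imp (N i a) (N i b)))
| A4 i s : subjective i s -> AX' (Imp s (And (L i s) (N i s)))
| A5' i a : objective i a ->
    AX' (Imp (Sat (Not a)) (Imp (N i a) (Not (L i a))))
| V1 phi psi : AX' (Imp (And (Val phi) (Val (Imp phi psi))) (Val psi))
| V2 phi : propositional phi -> satisfiable phi -> AX' (Sat phi)
| V3 i a c (bs ds : seq (form Phi n)) :
    objective i a -> objective i c ->
    all (objective i) bs -> all (objective i) ds ->
    AX' (Imp
      (foldr And (Val (Or a c))
        ([seq Sat (And a b) | b <- bs] ++ [seq Sat (And c d) | d <- ds]))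
      (Sat (bigAnd (L i a)
        ([seq Not (L i (Not b)) | b <- bs] ++
         N i c :: [seq Not (N i (Not d)) | d <- ds]))))
| V4 i a b : objective i a -> subjective i b ->
    AX' (Imp (And (Sat a) (Sat b)) (Sat (And a b)))
| MP a b : AX' a -> AX' (Imp a b) -> AX' b
| NecL i a : AX' a -> AX' (L i a)
| NecN i a : AX' a -> AX' (N i a)
| NecVal phi : AX' phi -> AX' (Val phi).

End Syntax.

(* Main.v *)
(** Call a formula normal if every [L i a] and [N i a] in it has an i-objective
    argument.  Relative to a context deciding the i-subjective letters of [a],
    A4 makes [L i a] equivalent to [L i o] with [o] i-objective, so a case split
    shows that every formula of ONL_n is provably equivalent to a normal one.
    By induction on the modal depth, a normal formula is either refutable or
    provably satisfiable: if it is not refutable it follows from an irrefutable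
    list of literals.  V2 gives Sat for the propositional literals, and V4 adds
    the literals of one agent at a time.  For agent i, V3 applies: by the
    induction hypothesis each of its premises is either provable or fails
    provably, and in the latter case the literals of agent i are refutable
    (by A5' when the premise [Val (alpha \/ gamma)] fails). *)
Require Import Defs.
From mathcomp Require Import all_boot.
From Stdlib Require Import Classical.
From Stdlib Require List.

Set Implicit Arguments.
Unset Strict Implicit.
Unset Printing Implicit Defensive.

Ltac taut :=
  let v := fresh "v" in
  intro v; simpl;
  repeat match goal with
  | |- context [beval v ?x] => destruct (beval v x)
  | |- context [v ?x] => destruct (v x)
  end; done.

(** * List membership over types without decidable equality *)

Section Membership.
Variables (T U : Type).

Lemma in_catP (r1 r2 : seq T) x :
  List.In x (r1 ++ r2) <-> List.In x r1 \/ List.In x r2.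
Proof. exact: List.in_app_iff. Qed.

Lemma in_filterP (P : pred T) (r : seq T) x :
  List.In x (filter P r) <-> List.In x r /\ P x.
Proof. exact: List.filter_In. Qed.

Lemma in_mapP (f : T -> U) (r : seq T) y :
  List.In y (map f r) <-> exists2 x, List.In x r & y = f x.
Proof.
elim: r => [|x r IH] /=; first by split=> [|[]].
split=> [[<-|/IH[z Hz ->]]|[z [->|Hz] y_fz]].
- by exists x => //; left.
- by exists z => //; right.
- by left.
- by right; apply/IH; exists z.
Qed.

End Membership.

(** * Derived rules for [L], [N], [Val] and [Sat] *)

Section Derivations.
Variables (Phi : Type) (n : nat).
Implicit Types (a b c chi phi psi : form Phi n) (s : seq (form Phi n)).
Implicit Types (i j : 'I_n) (k : bool) (d : nat).

Lemma taut1 a b : AX' a -> tautology (Imp a b) -> AX' b.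
Proof. by move=> Ha /A1; apply: MP. Qed.

Lemma taut2 a b c : AX' a -> AX' b -> tautology (Imp a (Imp b c)) -> AX' c.
Proof. by move=> Ha Hb /(taut1 Ha); apply: MP. Qed.

Lemma taut3 a b c phi : AX' a -> AX' b -> AX' c ->
  tautology (Imp a (Imp b (Imp c phi))) -> AX' phi.
Proof. by move=> Ha Hb Hc /(taut2 Ha Hb); apply: MP. Qed.

(** Indexing by a boolean lets one proof serve both modalities. *)
Definition box k i a := if k then L i a else N i a.

Lemma boxK k i a b : AX' (Imp (box k i (Imp a b)) (Imp (box k i a) (box k i b))).
Proof. by case: k; [apply: A2 | apply: A3]. Qed.

Lemma box_nec k i a : AX' a -> AX' (box k i a).
Proof. by case: k; [apply: NecL | apply: NecN]. Qed.

Lemma box_mono k i a b : AX' (Imp a b) -> AX' (Imp (box k i a) (box k i b)).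
Proof. by move=> /(box_nec k i) H; apply: MP H (boxK _ _ _ _). Qed.

Lemma subjective_box k i chi : subjective i chi -> AX' (Imp chi (box k i chi)).
Proof. by move=> /A4 H; case: k; apply: (taut1 H); taut. Qed.

(** A4 moves the subjective context [chi] under the modality, where the implication can then be
    used. *)
Lemma box_mono_under k i chi a b : subjective i chi ->
  AX' (Imp chi (Imp a b)) -> AX' (Imp chi (Imp (box k i a) (box k i b))).
Proof.
move=> /(subjective_box k) H1 /(box_mono k i) H2.
by apply: (taut3 H1 H2 (boxK k i a b)); taut.
Qed.

Lemma Val_mono a b : AX' (Imp a b) -> AX' (Imp (Val a) (Val b)).
Proof. by move=> /NecVal H; apply: (taut2 H (V1 a b)); taut. Qed.

Lemma Sat_mono a b : AX' (Imp a b) -> AX' (Sat a) -> AX' (Sat b).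
Proof.
move=> Hab Ha; have H : AX' (Imp (Not b) (Not a)) by apply: (taut1 Hab); taut.
by apply: (taut2 (Val_mono H) Ha); taut.
Qed.

Definition decides chi a := AX' (Imp chi a) \/ AX' (Imp chi (Not a)).

(** As in [beval], modal formulas are opaque: their arguments are not searched. *)
Fixpoint letters psi : seq (form Phi n) :=
  match psi with
  | Not a => letters a
  | Or a b => letters a ++ letters b
  | _ => [:: psi]
  end.

Lemma decides_letters chi psi :
  (forall a, List.In a (letters psi) -> decides chi a) -> decides chi psi.
Proof.
elim: psi => [p|a IHa|a IHa b IHb|i a _|i a _|a _] /= H; try by apply: H; left.
- by case: (IHa H) => Ha; [right | left]; apply: (taut1 Ha); taut.
- have Ha : decides chi a by apply: IHa => x Hx; apply: H; apply/in_catP; left.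
  have Hb : decides chi b by apply: IHb => x Hx; apply: H; apply/in_catP; right.
  case: Ha => Ha; first by left; apply: (taut1 Ha); taut.
  case: Hb => Hb; first by left; apply: (taut1 Hb); taut.
  by right; apply: (taut2 Ha Hb); taut.
Qed.

Lemma bigAnd_elim phi s a : List.In a (phi :: s) -> AX' (Imp (bigAnd phi s) a).
Proof.
elim: s phi => [|b s IH] phi /=; first by case=> // ->; apply: A1; taut.
case=> [->|/IH H]; first by apply: A1; taut.
by apply: (taut1 H); taut.
Qed.

Lemma foldr_And_intro phi s : AX' phi -> (forall a, List.In a s -> AX' a) ->
  AX' (foldr (@And Phi n) phi s).
Proof.
move=> Hphi; elim: s => //= a s IH H.
have Ha : AX' a by apply: H; left.
have Hs : AX' (foldr (@And Phi n) phi s) by apply: IH => x Hx; apply: H; right.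
by apply: (taut2 Ha Hs); taut.
Qed.

(** * Reduction to normal formulas *)

(* Normal formulas of modal depth at most [d]. *)
Fixpoint nf d psi : bool :=
  match psi with
  | Atom _ => true
  | Not a => nf d a
  | Or a b => nf d a && nf d b
  | L i a | N i a => if d is d'.+1 then objective i a && nf d' a else false
  | Val _ => false
  end.

Lemma nf_leq d d' psi : d <= d' -> nf d psi -> nf d' psi.
Proof.
elim: psi d d' => [p|a IHa|a IHa b IHb|i a IHa|i a IHa|a _] d d' //= le_dd'.
- exact: IHa.
- by case/andP=> /(IHa _ _ le_dd') -> /(IHb _ _ le_dd').
- by case: d d' le_dd' => [|d] [|d'] //= le_dd' /andP[-> /(IHa d d' le_dd')].
- by case: d d' le_dd' => [|d] [|d'] //= le_dd' /andP[-> /(IHa d d' le_dd')].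
Qed.

Lemma nf0_propositional psi : nf 0 psi -> propositional psi.
Proof. by elim: psi => //= a IHa b IHb /andP[/IHa -> /IHb ->]. Qed.

Lemma nf_letters d psi a : nf d psi -> List.In a (letters psi) -> nf d a.
Proof.
elim: psi => [p|b IHb|b IHb c IHc|i b _|i b _|b _] //=.
- by move=> _ [<-|].
- by case/andP=> /IHb Hb /IHc Hc /in_catP[/Hb|/Hc].
- by move=> H [<-|].
- by move=> H [<-|].
Qed.

Definition Iff a b := And (Imp a b) (Imp b a).

(* [psi] may depend on the context [chi'], so the equivalents obtained in the
   various cases are glued with the letters of [s] as guards. *)
Lemma case_split i d phi s chi : subjective i chi ->
  (forall a, List.In a s -> subjective i a && nf d a) ->
  (forall chi', subjective i chi' -> AX' (Imp chi' chi) ->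
     (forall a, List.In a s -> decides chi' a) ->
     exists2 psi, nf d psi & AX' (Imp chi' (Iff phi psi))) ->
  exists2 psi, nf d psi & AX' (Imp chi (Iff phi psi)).
Proof.
elim: s chi => [|a s IH] chi subj_chi Hs H.
  by apply: H => //; apply: A1; taut.
have /andP[subj_a nf_a] := Hs a (or_introl erefl).
have {}Hs b : List.In b s -> subjective i b && nf d b.
  by move=> Hb; apply: Hs; right.
have split_on l : subjective i l -> decides l a ->
    exists2 psi, nf d psi & AX' (Imp (And chi l) (Iff phi psi)).
  move=> subj_l dec_l; apply: IH => //=; first by rewrite subj_chi.
  move=> chi' subj_chi' chi'P dec; apply: H => //.
    by apply: (taut1 chi'P); taut.
  move=> b [<-|/dec //].
  by case: dec_l => dec_l; [left | right]; apply: (taut2 chi'P dec_l); taut.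
have [|psi1 nf1 H1] := split_on a subj_a; first by left; apply: A1; taut.
have [|psi2 nf2 H2] := split_on (Not a) subj_a; first by right; apply: A1; taut.
exists (Or (And a psi1) (And (Not a) psi2)); first by rewrite /= nf_a nf1 nf2.
by apply: (taut2 H1 H2); taut.
Qed.

End Derivations.

Section Decision.
Variables (Phi : Type) (n : nat) (p : Phi).
Implicit Types (a b c chi phi psi : form Phi n) (s : seq (form Phi n)).
Implicit Types (i j : 'I_n) (k : bool) (d : nat).

(** The language has no truth constant. This tautology is objective for every agent and normal at
    depth 0. *)
Definition Top : form Phi n := Or (Atom p) (Not (Atom p)).

(** Every letter of a normal formula is objective or subjective for [i]; the subjective ones become
    [Top] or [Not Top], as [chi] dictates. *)
Lemma objective_under i d a chi : nf d a ->
  (forall b, List.In b (letters a) -> subjective i b -> decides chi b) ->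
  exists2 o, objective i o && nf d o & AX' (Imp chi (Iff a o)).
Proof.
have letter b : nf d b -> objective i b || subjective i b ->
    (subjective i b -> decides chi b) ->
    exists2 o, objective i o && nf d o & AX' (Imp chi (Iff b o)).
  move=> nf_b; case: (boolP (objective i b)) => /= [obj_b _ _|_ -> /(_ isT) [] H].
  - by exists b; [rewrite obj_b | apply: A1; taut].
  - by exists Top => //; apply: (taut1 H); taut.
  - by exists (Not Top) => //; apply: (taut1 H); taut.
elim: a => [q|a IHa|a IHa b IHb|j a _|j a _|a _] // nf_a dec.
- by apply: letter => // _; apply: dec => //; left.
- have [o Ho H] := IHa nf_a dec.
  by exists (Not o) => //; apply: (taut1 H); taut.
- case/andP: nf_a => nf_a nf_b.
  have [|o1 /andP[obj1 nf1] H1] := IHa nf_a.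
    by move=> x Hx; apply: dec; apply/in_catP; left.
  have [|o2 /andP[obj2 nf2] H2] := IHb nf_b.
    by move=> x Hx; apply: dec; apply/in_catP; right.
  exists (Or o1 o2); first by rewrite /= obj1 obj2 nf1 nf2.
  by apply: (taut2 H1 H2); taut.
- by apply: letter => [//||]; [rewrite /= orNb | apply: dec; left].
- by apply: letter => [//||]; [rewrite /= orNb | apply: dec; left].
Qed.

Lemma normal_box k i d a : nf d a ->
  exists2 psi, nf d.+1 psi & AX' (Iff (box k i a) psi).
Proof.
(* The initial context must be provable and i-subjective; [Top], built from an atom, is not
   i-subjective. *)
move=> nf_a; pose chi := Or (L i a) (Not (L i a)).
have subj_chi : subjective i chi by rewrite /= eqxx.
have [||psi nf_psi H] := @case_split _ _ i d.+1 (box k i a)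
    (filter (subjective i) (letters a)) chi subj_chi.
- move=> b /in_filterP[/(nf_letters nf_a) nf_b ->].
  exact: nf_leq (leqnSn d) nf_b.
- move=> chi' subj_chi' _ dec.
  have [|o /andP[obj_o nf_o] H] := @objective_under i d a chi' nf_a.
    by move=> b Hb subj_b; apply: dec; apply/in_filterP.
  exists (box k i o); first by case: k {dec} => /=; rewrite obj_o nf_o.
  have H1 : AX' (Imp chi' (Imp a o)) by apply: (taut1 H); taut.
  have H2 : AX' (Imp chi' (Imp o a)) by apply: (taut1 H); taut.
  apply: (taut2 (box_mono_under k subj_chi' H1) (box_mono_under k subj_chi' H2)).
  by taut.
- by exists psi => //; apply: (taut1 H); taut.
Qed.

Lemma normalization phi : in_ONL phi ->
  exists d, exists2 psi, nf d psi & AX' (Iff phi psi).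
Proof.
have box_step k i a : (exists d, exists2 psi, nf d psi & AX' (Iff a psi)) ->
    exists d, exists2 psi, nf d psi & AX' (Iff (box k i a) psi).
  move=> [d [a' nf_a' H]]; have [psi nf_psi H'] := normal_box k i nf_a'.
  exists d.+1, psi => //.
  have H1 : AX' (Imp a a') by apply: (taut1 H); taut.
  have H2 : AX' (Imp a' a) by apply: (taut1 H); taut.
  by apply: (taut3 (box_mono k i H1) (box_mono k i H2) H'); taut.
elim: phi => [q|a IHa|a IHa b IHb|i a IHa|i a IHa|a _] //=.
- by exists 0, (Atom q) => //; apply: A1; taut.
- move=> /IHa[d [psi nf_psi H]]; exists d, (Not psi) => //.
  by apply: (taut1 H); taut.
- case/andP=> /IHa[d1 [psi1 nf1 H1]] /IHb[d2 [psi2 nf2 H2]].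
  exists (maxn d1 d2), (Or psi1 psi2); last by apply: (taut2 H1 H2); taut.
  by rewrite /= (nf_leq (leq_maxl d1 d2) nf1) (nf_leq (leq_maxr d1 d2) nf2).
- by move=> /IHa; apply: (box_step true).
- by move=> /IHa; apply: (box_step false).
Qed.

(** * Conjunctions and lists of literals *)

Definition conj s := foldr (@And Phi n) Top s.

Lemma conj_elim s a : List.In a s -> AX' (Imp (conj s) a).
Proof.
elim: s => //= b s IH [->|/IH H]; first by apply: A1; taut.
by apply: (taut1 H); taut.
Qed.

Lemma conj_intro chi s :
  (forall a, List.In a s -> AX' (Imp chi a)) -> AX' (Imp chi (conj s)).
Proof.
elim: s => [_|b s IH H] /=; first by apply: A1; taut.
have Hb := H b (or_introl erefl).
have Hs : AX' (Imp chi (conj s)) by apply: IH => a Ha; apply: H; right.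
by apply: (taut2 Hb Hs); taut.
Qed.

Lemma box_conj k i chi s :
  (forall a, List.In a s -> AX' (Imp chi (box k i a))) ->
  AX' (Imp chi (box k i (conj s))).
Proof.
elim: s => [_|b s IH H] /=.
  have HT : AX' (box k i Top) by apply: box_nec; apply: A1; taut.
  by apply: (taut1 HT); taut.
have Hb := H b (or_introl erefl).
have Hs : AX' (Imp chi (box k i (conj s))) by apply: IH => a Ha; apply: H; right.
have Hpair : AX' (Imp b (Imp (conj s) (And b (conj s)))) by apply: A1; taut.
have Hbox : AX' (Imp (box k i b) (Imp (box k i (conj s)) (box k i (And b (conj s))))).
  by apply: (taut2 (box_mono k i Hpair) (boxK k i (conj s) (And b (conj s)))); taut.
by apply: (taut3 Hb Hs Hbox); taut.
Qed.

Lemma objective_conj i s :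
  (forall a, List.In a s -> objective i a) -> objective i (conj s).
Proof.
elim: s => //= a s IH H; rewrite (H a (or_introl erefl)) /=.
by apply: IH => b Hb; apply: H; right.
Qed.

Lemma nf_conj d s : (forall a, List.In a s -> nf d a) -> nf d (conj s).
Proof.
elim: s => //= a s IH H; rewrite (H a (or_introl erefl)) /=.
by apply: IH => b Hb; apply: H; right.
Qed.

(* The literal [(true, a)] stands for [a] and [(false, a)] for [Not a]. *)
Definition lit (l : bool * form Phi n) := if l.1 then l.2 else Not l.2.
Implicit Types (l : bool * form Phi n) (ls : seq (bool * form Phi n)).

Definition lits ls := conj (map lit ls).

Lemma lits_elim ls l : List.In l ls -> AX' (Imp (lits ls) (lit l)).
Proof. by move=> Hl; apply: conj_elim; apply/in_mapP; exists l. Qed.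

(** A finite Lindenbaum construction: if both signs of a letter were refutable together with [chi],
    so would [chi] be. *)
Lemma complete_lits s chi : ~ AX' (Not chi) ->
  exists2 ls, map snd ls = s & ~ AX' (Not (And chi (lits ls))).
Proof.
elim: s chi => [|a s IH] chi cons_chi.
  by exists [::] => // H; apply: cons_chi; apply: (taut1 H); taut.
have [sgn cons_sgn] : exists sgn, ~ AX' (Not (And chi (lit (sgn, a)))).
  apply: NNPP => H; apply: cons_chi.
  have H1 : AX' (Not (And chi a)) by apply: NNPP => H1; apply: H; exists true.
  have H2 : AX' (Not (And chi (Not a))) by apply: NNPP => H2; apply: H; exists false.
  by apply: (taut2 H1 H2); taut.
have [ls <- cons_ls] := IH _ cons_sgn.
exists ((sgn, a) :: ls) => // H; apply: cons_ls.
by apply: (taut1 H); rewrite /lits /=; taut.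
Qed.

Definition box_arg k i a : option (form Phi n) :=
  match a with
  | L j b => if k && (j == i) then Some b else None
  | N j b => if ~~ k && (j == i) then Some b else None
  | _ => None
  end.

Lemma box_argP k i a b : box_arg k i a = Some b <-> a = box k i b.
Proof.
split=> [|->]; last by case: k; rewrite /= eqxx.
by case: a => //= j a; case: k => //=; case: eqP => // -> [->].
Qed.

Definition args sgn k i ls :=
  pmap (fun l => if l.1 == sgn then box_arg k i l.2 else None) ls.

Lemma in_args sgn k i ls a :
  List.In a (args sgn k i ls) <-> List.In (sgn, box k i a) ls.
Proof.
elim: ls => //= -[sgn' b] ls IH /=.
case: eqP => [->|ne]; last first.
  by rewrite IH; split=> [|[[]|]] //; right.
case E: (box_arg k i b) => [b'|] /=.
  move/box_argP: E => ->; rewrite IH; split=> -[H|H]; try by right.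
    by left; rewrite H.
  left; case: H => H; apply: Some_inj.
  by rewrite -[LHS](proj2 (box_argP k i _ _) erefl) H; apply/box_argP.
rewrite IH; split=> [|[[/box_argP]|//]]; first by right.
by rewrite E.
Qed.

(** Atoms pass for every [m], so bound 0 keeps exactly the propositional letters and each increment
    admits one more agent. *)
Definition agent_lt m a :=
  match a with
  | Atom _ => true
  | L j _ | N j _ => j < m
  | _ => false
  end.

Definition is_letter a := if a is (Not _ | Or _ _) then false else true.

Lemma letters_is_letter psi a : List.In a (letters psi) -> is_letter a.
Proof.
elim: psi => [q|b IHb|b IHb c IHc|i b _|i b _|b _] //=; try by case=> // <-.
by case/in_catP; [apply: IHb | apply: IHc].
Qed.

(** * From depth [d] to depth [d.+1]: an irrefutable list of literals is provably satisfiable *)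

Section Step.
Variables (d : nat) (ls : seq (bool * form Phi n)).
Hypothesis IHd : forall psi, nf d psi -> AX' (Not psi) \/ AX' (Sat psi).
Hypothesis cons_ls : ~ AX' (Not (lits ls)).
Hypothesis letter_ls : forall l, List.In l ls -> is_letter l.2 && nf d.+1 l.2.

Lemma args_objective sgn k i a :
  List.In a (args sgn k i ls) -> objective i a && nf d a.
Proof. by move/in_args/letter_ls; case: k. Qed.

(** These are alpha ([k = true]) and gamma ([k = false]) in the instance of V3 for agent [i]. *)
Let know k i := conj (args true k i ls).

Lemma know_objective k i : objective i (know k i).
Proof. by apply: objective_conj => a /args_objective/andP[]. Qed.

Lemma know_nf k i : nf d (know k i).
Proof. by apply: nf_conj => a /args_objective/andP[]. Qed.

Lemma lits_know k i : AX' (Imp (lits ls) (box k i (know k i))).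
Proof. by apply: box_conj => a /in_args/lits_elim. Qed.

(** Otherwise [know k i] provably implies [a], so the positive literals yield [box k i a], against
    the literal denying it. *)
Lemma Sat_considered k i a : List.In a (args false k i ls) ->
  AX' (Sat (And (know k i) (Not a))).
Proof.
move=> Ha; have /andP[_ nf_a] := args_objective Ha.
case: (IHd (psi := And (know k i) (Not a))) => //= [|H].
  by rewrite know_nf nf_a.
case: cons_ls; move/in_args/lits_elim: Ha => Ha.
have /(box_mono k i) H' : AX' (Imp (know k i) a) by apply: (taut1 H); taut.
by apply: (taut3 (lits_know k i) H' Ha); rewrite /lit; taut.
Qed.

(** If the disjunction [o] is not provable, [Not o] is provably satisfiable, and A5' forbids [L i o]
    together with [N i o]; yet the literals imply both, since each disjunct implies [o]. *)
Lemma Val_know i : AX' (Val (Or (know true i) (know false i))).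
Proof.
set o := Or _ _.
have obj_o : objective i o by rewrite /= !know_objective.
case: (IHd (psi := Not o)); first by rewrite /= !know_nf.
  by move=> H; apply: NecVal; apply: (taut1 H); taut.
move=> /MP/(_ (A5' obj_o)) H; case: cons_ls.
have lits_o k : AX' (Imp (lits ls) (box k i o)).
  have Ho : AX' (Imp (know k i) o) by case: k; apply: A1; taut.
  by apply: (taut2 (lits_know k i) (box_mono k i Ho)); taut.
by apply: (taut3 (lits_o true) (lits_o false) H); taut.
Qed.

Lemma Sat_agent i : exists B : form Phi n, [/\ subjective i B, AX' (Sat B) &
  forall sgn k a, List.In (sgn, box k i a) ls -> AX' (Imp B (lit (sgn, box k i a)))].
Proof.
pose beta k := map (@Not Phi n) (args false k i ls).
pose B := bigAnd (L i (know true i))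
  ([seq Not (L i (Not b)) | b <- beta true] ++
   N i (know false i) :: [seq Not (N i (Not b)) | b <- beta false]).
have objective_beta k : all (objective i) (beta k).
  rewrite all_map; have := @args_objective false k i.
  elim: (args _ _ _ _) => //= a s IH H.
  have /andP[-> _] := H a (or_introl erefl).
  by apply: IH => b Hb; apply: H; right.
exists B; split.
- have sub_bigAnd phi s : all (subjective i) (phi :: s) -> subjective i (bigAnd phi s).
    by elim: s phi => [|b s IH] phi /= /andP[-> //] /IH.
  by apply: sub_bigAnd; rewrite /= all_cat /= !all_map eqxx /=; apply/andP; split;
    apply/allT => b /=; rewrite eqxx.
- apply: MP (V3 (know_objective true i) (know_objective false i)
                (objective_beta true) (objective_beta false)).
  apply: foldr_And_intro (Val_know i) _ => a /in_catP.
  by case=> /in_mapP[b /in_mapP[c Hc ->] ->]; apply: Sat_considered.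
- have B_know k : AX' (Imp B (box k i (know k i))).
    apply: bigAnd_elim; case: k; first by left.
    by right; apply/in_catP; right; left.
  move=> [] k a Ha; rewrite /lit /=.
    have H : AX' (Imp (know k i) a) by apply: conj_elim; apply/in_args.
    by apply: (taut2 (B_know k) (box_mono k i H)); taut.
  (* V3 puts a further negation on each beta and delta, here [Not a]; monotonicity of the modality
     removes the resulting double negation. *)
  have B_considers : AX' (Imp B (Not (box k i (Not (Not a))))).
    have Hbeta : List.In (Not a) (beta k).
      by apply/in_mapP; exists a => //; apply/in_args.
    apply: bigAnd_elim; right; apply/in_catP.
    case: k Ha Hbeta => _ Hbeta.
      by left; apply/in_mapP; exists (Not a).
    by right; right; apply/in_mapP; exists (Not a).
  have H : AX' (Imp a (Not (Not a))) by apply: A1; taut.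
  by apply: (taut2 B_considers (box_mono k i H)); taut.
Qed.

Let lits_lt m := lits (filter (fun l => agent_lt m l.2) ls).

Lemma lits_lt_elim m l : List.In l ls -> agent_lt m l.2 ->
  AX' (Imp (lits_lt m) (lit l)).
Proof. by move=> Hl lt_l; apply: lits_elim; apply/in_filterP. Qed.

(** Agents are added one at a time: V2 settles the atoms, and V4 joins the literals collected so far
    with the formula for agent [m]. *)
Lemma Sat_lits_lt m : m <= n -> AX' (Sat (lits_lt m)).
Proof.
elim: m => [_|m IHm lt_mn].
  apply: V2.
    rewrite /lits_lt /lits; elim: ls => //= -[sgn a] r IH.
    by case: a => //= q; case: sgn.
  (* If no valuation satisfied the propositional literals, their negation would be an instance of
     A1. *)
  apply: NNPP => unsat; apply: cons_ls.
  have H : AX' (Imp (lits ls) (lits_lt 0)).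
    by apply: conj_intro => _ /in_mapP[l /in_filterP[Hl _] ->]; apply: lits_elim.
  have H' : AX' (Not (lits_lt 0)).
    by apply: A1 => v /=; apply/negP => Hv; apply: unsat; exists v.
  by apply: (taut2 H H'); taut.
pose i := Ordinal lt_mn; have [B [subj_B Sat_B B_lits]] := Sat_agent i.
(* So far only atoms and modalities of agents other than [i] occur, as V4 requires. *)
have obj_lt : objective i (lits_lt m).
  apply: objective_conj => _ /in_mapP[[sgn a] /in_filterP[_ /= lt_a] ->].
  suff: objective i a by case: sgn.
  by case: a lt_a => //= j a; rewrite -val_eqE /= => /ltn_eqF ->.
have := IHm (ltnW lt_mn) => Sat_m.
have Sat_both : AX' (Sat (And (lits_lt m) B)).
  by apply: MP (V4 obj_lt subj_B); apply: (taut2 Sat_m Sat_B); taut.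
apply: Sat_mono Sat_both; apply: conj_intro.
move=> _ /in_mapP[[sgn a] /in_filterP[Ha /= lt_a] ->].
have box_case k j b : a = box k j b -> j < m.+1 ->
    AX' (Imp (And (lits_lt m) B) (lit (sgn, a))).
  rewrite ltnS leq_eqVlt => def_a /orP[/eqP eq_j|lt_j].
    have eq_ji : j = i by apply: val_inj.
    rewrite {}eq_ji in def_a; rewrite def_a in Ha *.
    by apply: (taut1 (B_lits _ _ _ Ha)); taut.
  have lt_a' : agent_lt m a by rewrite def_a; case: k {def_a}.
  by apply: (taut1 (lits_lt_elim Ha lt_a')); taut.
case def_a: a lt_a => [q|b|b c|j b|j b|b] //= lt_j; rewrite -?def_a.
- by rewrite def_a in Ha *; apply: (taut1 (lits_lt_elim (m := m) Ha isT)); taut.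
- exact: (box_case true j b).
- exact: (box_case false j b).
Qed.

Lemma Sat_lits : AX' (Sat (lits ls)).
Proof.
apply: Sat_mono (Sat_lits_lt (leqnn n)).
apply: conj_intro => _ /in_mapP[l Hl ->]; apply: lits_lt_elim => //.
(* Being a letter excludes connectives, normality excludes [Val], and every agent lies below [n]. *)
by have := letter_ls Hl; case: l.2 => //= j a.
Qed.

End Step.

(** * Decision for normal formulas, and the theorem *)

Lemma normal_decision d psi : nf d psi -> AX' (Not psi) \/ AX' (Sat psi).
Proof.
elim: d psi => [|d IHd] psi nf_psi; case: (classic (AX' (Not psi))); try by left.
  move=> cons_psi; right; apply: V2; first exact: nf0_propositional.
  apply: NNPP => unsat; apply: cons_psi.
  by apply: A1 => v /=; apply/negP => Hv; apply: unsat; exists v.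
move=> /(complete_lits (letters psi))[ls def_ls cons_ls]; right.
have letter_ls l : List.In l ls -> is_letter l.2 && nf d.+1 l.2.
  move=> Hl; have Hl2 : List.In l.2 (letters psi).
    by rewrite -def_ls; apply/in_mapP; exists l.
  by rewrite (letters_is_letter Hl2) (nf_letters nf_psi Hl2).
(* The list gives a sign to every letter of [psi], so it decides [psi]; a negative verdict
   contradicts its consistency with [psi]. *)
have [H|H] : decides (lits ls) psi.
- apply: decides_letters => a; rewrite -def_ls => /in_mapP[[sgn b] Hl ->].
  by have := lits_elim Hl; case: sgn {Hl}; [left | right].
- apply: (Sat_mono H); apply: (Sat_lits IHd) => // H'.
  by apply: cons_ls; apply: (taut1 H'); taut.
- by case: cons_ls; apply: (taut1 H); taut.
Qed.

End Decision.

Theorem proposition5p1 (Phi : Type) (n : nat) (Phi_nonempty : inhabited Phi)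
    (phi : form Phi n) (phi_ONL : in_ONL phi) :
  (AX' phi -> AX' (Val phi)) /\ (~ AX' phi -> AX' (Not (Val phi))).
Proof.
split=> [|unprov]; first exact: NecVal.
case: Phi_nonempty => p.
have [d [psi nf_psi H]] := normalization p phi_ONL.
have [H'|Sat_psi] := normal_decision (psi := Not psi) p nf_psi.
  by case: unprov; apply: (taut2 H H'); taut.
(* [Sat (Not psi)] unfolds to [Not (Val (Not (Not psi)))], whence the double negation. *)
have H' : AX' (Imp phi (Not (Not psi))) by apply: (taut1 H); taut.
by apply: (taut2 (Val_mono H') Sat_psi); taut.
Qed.
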